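(* Let $U_1,V_1,W_1,U_2,V_2,W_2$ be finite-dimensional real vector spaces with fixed bases. For all $A\in U_1^+\otimes V_1^+\otimes W_1^+$ and $B\in U_2^+\otimes V_2^+\otimes W_2^+$, $$\operatorname{rank}_+(A\oplus B)=\operatorname{rank}_+(A)+\operatorname{rank}_+(B).$$
   Context: For a real vector space $V$ with a fixed basis, $V^+$ is the set of vectors with nonnegative coordinates; $U^+\otimes V^+\otimes W^+$ is the cone of nonnegative tensors in $U\otimes V\otimes W$ (tensors all of whose coordinates are nonnegative). The nonnegative rank $\operatorname{rank}_+(T)$ of $T\in U^+\otimes V^+\otimes W^+$ is the minimum $r$ such that $T=\sum_{i=1}^r u_i\otimes v_i\otimes w_i$ with $u_i\in U^+,v_i\in V^+,w_i\in W^+$ (and it is $0$ iff $T=0$). The direct sum $A\oplus B\in (U_1\oplus U_2)\otimes(V_1\oplus V_2)\otimes(W_1\oplus W_2)$ is the sum of the images of $A$ and $B$ under the natural inclusions (block-diagonal hypermatrix with blocks $A$ and $B$). The bases of $U_1\oplus U_2$, $V_1\oplus V_2$, $W_1\oplus W_2$ are the concatenations of the fixed bases, so $a\oplus b$ has coordinates $(a_1,\dots,a_{m_1},b_1,\dots,b_{m_2})$ for $a\in U_1$, $b\in U_2$, and likewise for the others; nonnegativity and $\operatorname{rank}_+$ of $A\oplus B$ are taken with respect to these bases. *)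

(* Defs.v *)
From mathcomp Require Import all_boot all_order all_algebra.
From mathcomp Require Import boolp reals.

Set Implicit Arguments.
Unset Strict Implicit.
Unset Printing Implicit Defensive.

Import Order.TTheory GRing.Theory Num.Theory.
Local Open Scope ring_scope.

(* A finite-dimensional real vector space with a fixed basis is identified with
   its coordinate space 'rV[R]_m (m = 0 allowed), and U (x) V (x) W with the
   hypermatrices of coordinates in the product basis. *)
Notation tensor3 R m n p := {ffun 'I_m * 'I_n * 'I_p -> R}.

Definition nonneg_vec (R : realType) (m : nat) (u : 'rV[R]_m) : Prop :=
  forall i, 0 <= u 0 i.

Definition nonneg_tensor (R : realType) (m n p : nat)
    (T : tensor3 R m n p) : Prop :=
  forall x, 0 <= T x.

Definition pure_tensor (R : realType) (m n p : nat)
    (u : 'rV[R]_m) (v : 'rV[R]_n) (w : 'rV[R]_p) : tensor3 R m n p :=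
  [ffun x => u 0 x.1.1 * v 0 x.1.2 * w 0 x.2].

Definition nonneg_decomposition (R : realType) (m n p : nat)
    (T : tensor3 R m n p) (r : nat) : Prop :=
  exists (u : 'I_r -> 'rV[R]_m) (v : 'I_r -> 'rV[R]_n) (w : 'I_r -> 'rV[R]_p),
    (forall i, [/\ nonneg_vec (u i), nonneg_vec (v i) & nonneg_vec (w i)]) /\
    T = \sum_(i < r) pure_tensor (u i) (v i) (w i).

(* The value 0 in the second branch is a dummy, never used when T is
   nonnegative: see nonneg_decomposition_ex and nonneg_rankP. *)
Definition nonneg_rank (R : realType) (m n p : nat)
    (T : tensor3 R m n p) : nat :=
  match pselect (exists r, `[< nonneg_decomposition T r >]) with
  | left Tr => ex_minn Tr
  | right _ => 0%N
  end.

(* split sends an index of the concatenated basis to the summand it comes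
   from. *)
Definition direct_sum (R : realType) (m1 n1 p1 m2 n2 p2 : nat)
    (A : tensor3 R m1 n1 p1) (B : tensor3 R m2 n2 p2) :
    tensor3 R (m1 + m2) (n1 + n2) (p1 + p2) :=
  [ffun x => match split x.1.1, split x.1.2, split x.2 with
             | inl i, inl j, inl k => A (i, j, k)
             | inr i, inr j, inr k => B (i, j, k)
             | _, _, _ => 0
             end].

Lemma nonneg_decomposition_ex (R : realType) (m n p : nat)
    (T : tensor3 R m n p) :
  nonneg_tensor T -> exists r, nonneg_decomposition T r.
Proof.
move=> T0; pose I : finType := ('I_m * 'I_n * 'I_p)%type.
exists #|I|.
exists (fun a => T (enum_val a : I) *: delta_mx 0 (enum_val a : I).1.1).
exists (fun a => delta_mx 0 (enum_val a : I).1.2).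
exists (fun a => delta_mx 0 (enum_val a : I).2).
split.
  by move=> a; split=> b; rewrite !mxE ?mulr_ge0 ?ler0n.
apply/ffunP => -[[i j] k]; rewrite sum_ffunE.
rewrite -(big_enum_val
  (fun y : I => pure_tensor (T y *: delta_mx 0 y.1.1)
     (delta_mx 0 y.1.2) (delta_mx 0 y.2) (i, j, k))) /=.
rewrite (bigD1 (i, j, k)) //= big1 ?addr0.
  by rewrite ffunE !mxE /= !eqxx !mulr1.
move=> [[a b] c] /=; rewrite !xpair_eqE ffunE !mxE /=.
rewrite (eq_sym i) (eq_sym j) (eq_sym k).
by case: (a == i); case: (b == j); case: (c == k); rewrite //= ?(mulr0, mul0r).
Qed.

Lemma nonneg_rankP (R : realType) (m n p : nat) (T : tensor3 R m n p) :
  nonneg_tensor T ->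
  nonneg_decomposition T (nonneg_rank T) /\
  (forall r, nonneg_decomposition T r -> (nonneg_rank T <= r)%N).
Proof.
move=> /nonneg_decomposition_ex[r0 Tr0]; rewrite /nonneg_rank.
case: pselect => [Tr|[]]; last by exists r0; apply/asboolP.
by case: ex_minnP => r /asboolP Dr min_r; split=> // s Ds; apply/min_r/asboolP.
Qed.

Lemma nonneg_direct_sum (R : realType) (m1 n1 p1 m2 n2 p2 : nat)
    (A : tensor3 R m1 n1 p1) (B : tensor3 R m2 n2 p2) :
  nonneg_tensor A -> nonneg_tensor B -> nonneg_tensor (direct_sum A B).
Proof.
move=> A0 B0 x; rewrite ffunE.
by case: (split x.1.1) => ?; case: (split x.1.2) => ?;
   case: (split x.2) => ?.
Qed.

(* direct_sum A B is the sum of the images of A and B under the maps induced by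
   the inclusions u |-> row_mx u 0 and u |-> row_mx 0 u. *)
Lemma direct_sumE (R : realType) (m1 n1 p1 m2 n2 p2 : nat)
    (A : tensor3 R m1 n1 p1) (B : tensor3 R m2 n2 p2) :
  direct_sum A B = direct_sum A 0 + direct_sum 0 B.
Proof.
apply/ffunP => x; rewrite !ffunE.
by case: (split x.1.1) => ?; case: (split x.1.2) => ?;
   case: (split x.2) => ?; rewrite ?ffunE ?addr0 ?add0r.
Qed.

Lemma direct_sum_pure_l (R : realType) (m1 n1 p1 m2 n2 p2 : nat)
    (u : 'rV[R]_m1) (v : 'rV[R]_n1) (w : 'rV[R]_p1) :
  direct_sum (pure_tensor u v w) (0 : tensor3 R m2 n2 p2) =
  pure_tensor (row_mx u 0) (row_mx v 0) (row_mx w 0).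
Proof.
apply/ffunP => x; rewrite !ffunE !mxE.
by case: (split x.1.1) => ?; case: (split x.1.2) => ?;
   case: (split x.2) => ?; rewrite ?ffunE ?mxE ?(mulr0, mul0r).
Qed.

Lemma direct_sum_pure_r (R : realType) (m1 n1 p1 m2 n2 p2 : nat)
    (u : 'rV[R]_m2) (v : 'rV[R]_n2) (w : 'rV[R]_p2) :
  direct_sum (0 : tensor3 R m1 n1 p1) (pure_tensor u v w) =
  pure_tensor (row_mx 0 u) (row_mx 0 v) (row_mx 0 w).
Proof.
apply/ffunP => x; rewrite !ffunE !mxE.
by case: (split x.1.1) => ?; case: (split x.1.2) => ?;
   case: (split x.2) => ?; rewrite ?ffunE ?mxE ?(mulr0, mul0r).
Qed.

(* Main.v *)
(** Concatenating decompositions of [A] and [B] gives one inequality.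
Conversely, in a nonnegative decomposition of the direct sum no cancellation
can occur, so every summand vanishes outside the two diagonal blocks. A pure
tensor nonzero in the block of [A] and zero in the mixed block (1,1,2) has a
third factor supported on the first summand, so it is zero in the block of [B].
Hence the summands nonzero in the block of [A] suffice to decompose [A], and
the others suffice to decompose [B]. *)

Require Import Defs.
From mathcomp Require Import all_boot all_order all_algebra.
From mathcomp Require Import reals.
Local Open Scope ring_scope.

Set Implicit Arguments.
Unset Strict Implicit.
Import GRing.Theory Num.Theory.

(** Lets a subfamily of the summands count as a decomposition of length [#|S|]: [enum_val] renumbers
    the elements of [S]. *)
Lemma nonneg_decomposition_set (R : realType) (m n p : nat) (I : finType)
    (S : {set I}) (u : I -> 'rV[R]_m) (v : I -> 'rV[R]_n)
    (w : I -> 'rV[R]_p) :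
  (forall i, [/\ nonneg_vec (u i), nonneg_vec (v i) & nonneg_vec (w i)]) ->
  nonneg_decomposition (\sum_(i in S) pure_tensor (u i) (v i) (w i)) #|S|.
Proof.
move=> uvw0; exists (u \o enum_val), (v \o enum_val), (w \o enum_val).
split=> [i|]; first exact: uvw0.
by rewrite -(big_enum_val (fun i => pure_tensor (u i) (v i) (w i))).
Qed.

Lemma pure_tensor_ge0 (R : realType) (m n p : nat) (u : 'rV[R]_m)
    (v : 'rV[R]_n) (w : 'rV[R]_p) :
  nonneg_vec u -> nonneg_vec v -> nonneg_vec w ->
  nonneg_tensor (pure_tensor u v w).
Proof. by move=> u0 v0 w0 x; rewrite ffunE !mulr_ge0. Qed.

Section DirectSum.

Variables (R : realType) (m1 n1 p1 m2 n2 p2 : nat).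
Implicit Types (A : tensor3 R m1 n1 p1) (B : tensor3 R m2 n2 p2).

Lemma direct_sumD A A' B B' :
  direct_sum (A + A') (B + B') = direct_sum A B + direct_sum A' B'.
Proof.
apply/ffunP => x; rewrite !ffunE.
by case: (split x.1.1) => ?; case: (split x.1.2) => ?;
   case: (split x.2) => ?; rewrite ?ffunE ?addr0.
Qed.

Lemma direct_sum0 :
  direct_sum (0 : tensor3 R m1 n1 p1) (0 : tensor3 R m2 n2 p2) = 0.
Proof.
apply/ffunP => x; rewrite !ffunE.
by case: (split x.1.1) => ?; case: (split x.1.2) => ?;
   case: (split x.2) => ?; rewrite ?ffunE.
Qed.

Lemma direct_sum_lshift A B i j k :
  direct_sum A B (lshift m2 i, lshift n2 j, lshift p2 k) = A (i, j, k).
Proof. by rewrite ffunE /= !(unsplitK (inl _)). Qed.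

Lemma direct_sum_rshift A B i j k :
  direct_sum A B (rshift m1 i, rshift n1 j, rshift p1 k) = B (i, j, k).
Proof. by rewrite ffunE /= !(unsplitK (inr _)). Qed.

Lemma direct_sum_llr A B i j k :
  direct_sum A B (lshift m2 i, lshift n2 j, rshift p1 k) = 0.
Proof. by rewrite ffunE /= !(unsplitK (inl _)) (unsplitK (inr _)). Qed.

Lemma nonneg_decomposition_direct_sum A B r s :
  nonneg_decomposition A r -> nonneg_decomposition B s ->
  nonneg_decomposition (direct_sum A B) (r + s).
Proof.
move=> [uA [vA [wA [A0 ->]]]] [uB [vB [wB [B0 ->]]]].
(* The first [r] vectors are padded with zeros on the right, the last [s] on the left. *)
pose cat q1 q2 (f : 'I_r -> 'rV[R]_q1) (g : 'I_s -> 'rV[R]_q2) i :=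
  match split i with inl a => row_mx (f a) 0 | inr b => row_mx 0 (g b) end.
have cat0 q1 q2 f g : (forall a, nonneg_vec (f a)) ->
    (forall b, nonneg_vec (g b)) -> forall i, nonneg_vec (@cat q1 q2 f g i).
  move=> f0 g0 i j; rewrite /cat.
  by case: (split i) => a; rewrite mxE; case: (split j) => b;
     rewrite ?mxE //; [exact: f0 | exact: g0].
have catl q1 q2 f g a : @cat q1 q2 f g (lshift s a) = row_mx (f a) 0.
  by rewrite /cat (unsplitK (inl a)).
have catr q1 q2 f g b : @cat q1 q2 f g (rshift r b) = row_mx 0 (g b).
  by rewrite /cat (unsplitK (inr b)).
exists (cat _ _ uA uB), (cat _ _ vA vB), (cat _ _ wA wB); split=> [i|].
  by split; apply: cat0 => a; by [case: (A0 a)|case: (B0 a)].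
rewrite big_split_ord direct_sumE /=; congr (_ + _).
  (* Embedding as a diagonal block is additive, so it passes through the sum and acts on each pure
     tensor. *)
  rewrite (big_morph (fun A => direct_sum A 0) (id1 := 0) (op1 := +%R)).
  - by apply: eq_bigr => a _; rewrite !catl direct_sum_pure_l.
  - by move=> X Y; rewrite -direct_sumD addr0.
  - exact: direct_sum0.
rewrite (big_morph (direct_sum 0) (id1 := 0) (op1 := +%R)).
- by apply: eq_bigr => b _; rewrite !catr direct_sum_pure_r.
- by move=> X Y; rewrite -direct_sumD addr0.
- exact: direct_sum0.
Qed.

Lemma pure_tensor_block (u : 'rV[R]_(m1 + m2)) (v : 'rV[R]_(n1 + n2))
    (w : 'rV[R]_(p1 + p2)) :
  (forall i j k,
    pure_tensor u v w (lshift m2 i, lshift n2 j, rshift p1 k) = 0) ->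
  pure_tensor (lsubmx u) (lsubmx v) (lsubmx w) != 0 ->
  pure_tensor (rsubmx u) (rsubmx v) (rsubmx w) = 0.
Proof.
move=> uvw0 nz; apply/ffunP => y; rewrite !ffunE !mxE.
suff -> : w 0 (rshift p1 y.2) = 0 by rewrite mulr0.
(* If [w] had a nonzero coordinate at [y.2], the mixed block would force every product [u_i * v_j]
   over the first summands to vanish, and with it the block of [A]. *)
apply: contra_neq_eq nz => wy; apply/ffunP => x; rewrite !ffunE !mxE.
have /eqP := uvw0 x.1.1 x.1.2 y.2.
by rewrite ffunE /= mulf_eq0 (negPf wy) orbF => /eqP ->; rewrite mul0r.
Qed.

(** The lengths add up to exactly [r] because the two subfamilies, indexed by [S] and its
    complement, partition the summands. *)
Lemma nonneg_decomposition_direct_sum_inv A B r :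
  nonneg_decomposition (direct_sum A B) r ->
  exists s t, [/\ nonneg_decomposition A s, nonneg_decomposition B t &
                  (s + t)%N = r].
Proof.
move=> [u [v [w [uvw0 defAB]]]].
pose a i := pure_tensor (lsubmx (u i)) (lsubmx (v i)) (lsubmx (w i)).
pose b i := pure_tensor (rsubmx (u i)) (rsubmx (v i)) (rsubmx (w i)).
pose S := [set i | a i != 0].
have defA : A = \sum_(i in S) a i.
  (* Indices outside [S] contribute zero, so the sum may run over all summands, where it is the
     restriction of [defAB] to the first block. *)
  rewrite big_rmcond => [|i]; last by rewrite inE negbK => /eqP.
  apply/ffunP => -[[i j] k]; rewrite -(direct_sum_lshift A B) defAB !sum_ffunE.
  by apply: eq_bigr => l _; rewrite !ffunE !mxE.
have defB : B = \sum_(i in ~: S) b i.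
  rewrite big_rmcond => [|l].
    apply/ffunP => -[[i j] k].
    rewrite -(direct_sum_rshift A B) defAB !sum_ffunE.
    by apply: eq_bigr => l _; rewrite !ffunE !mxE.
  rewrite !inE negbK; apply: pure_tensor_block => i j k.
  (* A vanishing sum of nonnegative entries has only zero terms. *)
  have := direct_sum_llr A B i j k; rewrite defAB sum_ffunE => /psumr_eq0P.
  by apply=> // q _; case: (uvw0 q) => *; apply: pure_tensor_ge0.
exists #|S|, #|~: S|; split; last by rewrite cardsC card_ord.
- rewrite defA; apply: nonneg_decomposition_set => i.
  by case: (uvw0 i) => u0 v0 w0; split=> j; rewrite mxE.
- rewrite defB; apply: nonneg_decomposition_set => i.
  by case: (uvw0 i) => u0 v0 w0; split=> j; rewrite mxE.
Qed.

End DirectSum.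

Theorem lemma4p1 (R : realType) (m1 n1 p1 m2 n2 p2 : nat)
    (A : tensor3 R m1 n1 p1) (B : tensor3 R m2 n2 p2)
    (A_ge0 : nonneg_tensor A) (B_ge0 : nonneg_tensor B) :
  nonneg_rank (direct_sum A B) = (nonneg_rank A + nonneg_rank B)%N.
Proof.
have [decA minA] := nonneg_rankP A_ge0.
have [decB minB] := nonneg_rankP B_ge0.
have [decAB minAB] := nonneg_rankP (nonneg_direct_sum A_ge0 B_ge0).
apply/eqP; rewrite eqn_leq; apply/andP; split.
  exact/minAB/nonneg_decomposition_direct_sum.
have [s [t [/minA le_s /minB le_t <-]]] :=
  nonneg_decomposition_direct_sum_inv decAB.
exact: leq_add.
Qed.
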